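(* Let $d_1,d_2$ be integers with $2 \leq d_1 \leq d_2$. Consider the line arrangement $\mathcal{A} : f=0$ of $d=d_1+d_2 \geq 4$ lines in $\mathbb{P}^2$ (over $\mathbb{C}$) given by $$f(x,y,z)= x(y-z)\,g_{1,d_1-1}(x,y)\,g_{2,d_2}(x,z)=0,$$ where for integers $i\le j$, $g_{i,j}(u,v)=(u-iv)(u-(i+1)v)\cdots(u-jv)$. Then the following holds. (1) The line arrangement $\mathcal{A}$ is nearly free with exponents $(d_1,d_2)$. (2) The line arrangement $\mathcal{A}$ has at most two points of multiplicity $>3$.
   Context: Let $S=\mathbb{C}[x,y,z]$ with its standard grading. For a reduced curve $C:f=0$ of degree $d$ in $\mathbb{P}^2$ (in particular a line arrangement, where $f$ is a product of $d$ pairwise non-proportional linear forms), with partial derivatives $f_x,f_y,f_z$, let $AR(f)=\{(a,b,c)\in S^3 : af_x+bf_y+cf_z=0\}$ be the graded $S$-module of Jacobian syzygies; a homogeneous syzygy has degree $m$ if $a,b,c$ are homogeneous of degree $m$. The curve $C$ is nearly free with exponents $(d_1,d_2)$, $d_1\le d_2$, if $d_1+d_2=d$ and $AR(f)$ is minimally generated as a graded $S$-module by three homogeneous syzygies, of degrees $d_1, d_2, d_2$. The multiplicity of a point of a line arrangement is the number of lines of the arrangement passing through it. *)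

(* Defs.v *)
From mathcomp Require Import all_boot all_order all_algebra.
From mathcomp Require Import reals.
From mathcomp Require Export complex.
From mathcomp Require Export mpoly.

Set Implicit Arguments.
Unset Strict Implicit.
Unset Printing Implicit Defensive.

Import GRing.Theory.
Local Open Scope ring_scope.

Section PlaneCurves.

Variable K : fieldType.

Local Notation S := {mpoly K[3]}.

Implicit Types (f : S) (d : nat).

(* Squarefreeness; it forces f != 0. *)
Definition reduced f : Prop :=
  forall g h : S, f = g ^+ 2 * h -> g \is a GRing.unit.

Definition AR f (r : 'rV[S]_3) : Prop := \sum_i r 0 i * f^`M(i) = 0.

Definition homog_syzygy f d (r : 'rV[S]_3) : Prop :=
  AR f r /\ forall i, r 0 i \is d.-homog.

Definition generated_by (M : 'rV[S]_3 -> Prop) (n : nat)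
    (r : 'I_n -> 'rV[S]_3) (J : {set 'I_n}) : Prop :=
  forall s, M s <-> exists a : 'I_n -> S, s = \sum_(i in J) a i *: r i.

(* The zero row is homogeneous of every degree, but minimality prevents it
   from occurring among the generators, so their degrees are well defined. *)
Definition minimally_generated_in_degrees f (e : seq nat) : Prop :=
  exists r : 'I_(size e) -> 'rV[S]_3,
    [/\ forall i : 'I_(size e), homog_syzygy f (nth 0%N e i) (r i),
        generated_by (AR f) r [set: 'I_(size e)]
      & forall J, generated_by (AR f) r J -> J = [set: 'I_(size e)]].

Definition nearly_free f (d1 d2 : nat) : Prop :=
  [/\ f \is (d1 + d2).-homog, reduced f, (d1 <= d2)%N
    & minimally_generated_in_degrees f [:: d1; d2; d2]].

End PlaneCurves.

Section LineArrangements.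

Variable K : fieldType.

Local Notation S := {mpoly K[3]}.

(* Homogeneous coordinates represent points of P^2, and coefficient vectors of
   linear forms represent lines. Such a vector is a nonzero row, and two rows
   give the same point (line) iff they span the same row space. *)
Definition proj_distinct (s : seq 'rV[K]_3) : bool :=
  all (fun u => u != 0) s && pairwise (fun u v => ~~ (u == v)%MS) s.

Definition linear_form (a : 'rV[K]_3) : S := \sum_i a 0 i *: 'X_i.

Definition line_arrangement (A : seq 'rV[K]_3) (f : S) : Prop :=
  proj_distinct A /\ f = \prod_(a <- A) linear_form a.

Definition multiplicity (A : seq 'rV[K]_3) (p : 'rV[K]_3) : nat :=
  count (fun a => (linear_form a).@[p 0] == 0) A.

Definition g_factor (i j : nat) (u v : S) : S :=
  \prod_(i <= k < j.+1) (u - k%:R * v).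

Definition arr_poly (d1 d2 : nat) : S :=
  let x : S := 'X_0 in let y : S := 'X_1 in let z : S := 'X_2 in
  x * (y - z) * g_factor 1 (d1 - 1) x y * g_factor 2 d2 x z.

End LineArrangements.

(* Main.v *)
(* A syzygy is a derivation killing [f], and modulo the Euler derivation these
   are the derivations b d/dy + c d/dz preserving the ideal of every line. With
   P and Q the products of the lines x = k y and x = k z, this means b = P b',
   c = Q c' and P b' = Q c' modulo y - z. On the line y = z the polynomials P
   and Q have a common factor with coprime cofactors x - y and H, so that
   (b', c') = t (H, x - y) modulo y - z. Hence the three generators
   (y - z) P d/dy, (y - z) Q d/dz and P H d/dy + (x - y) Q d/dz; none is a
   combination of the other two, as evaluation at suitable points shows.
   A point of multiplicity > 3 must lie on two lines x = k y or on two lines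
   x = k z, so it is (0 : 0 : 1) or (0 : 1 : 0). *)
Require Import Defs.
From mathcomp Require Import all_boot all_order all_algebra.
From mathcomp Require Import reals complex mpoly ring zify.

Set Implicit Arguments.
Unset Strict Implicit.
Unset Printing Implicit Defensive.

Import Order.TTheory GRing.Theory Num.Theory.
Local Open Scope ring_scope.

(** * Divisibility and homogeneous quotients *)

Section Divisibility.

Variables (n : nat) (K : fieldType).
Implicit Types l p q : {mpoly K[n]}.

Definition mdvd l p : Prop := exists q, p = q * l.

Lemma mdvdnn l : mdvd l l.
Proof. by exists 1; rewrite mul1r. Qed.

Lemma mdvd0 l : mdvd l 0.
Proof. by exists 0; rewrite mul0r. Qed.

Lemma mdvdD l p q : mdvd l p -> mdvd l q -> mdvd l (p + q).
Proof. by move=> [u ->] [v ->]; exists (u + v); rewrite mulrDl. Qed.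

Lemma mdvdN l p : mdvd l p -> mdvd l (- p).
Proof. by move=> [u ->]; exists (- u); rewrite mulNr. Qed.

Lemma mdvdB l p q : mdvd l p -> mdvd l q -> mdvd l (p - q).
Proof. by move=> lp lq; apply/mdvdD/mdvdN. Qed.

Lemma mdvdMl l p q : mdvd l q -> mdvd l (p * q).
Proof. by move=> [u ->]; exists (p * u); rewrite mulrA. Qed.

Lemma mdvdMr l p q : mdvd l p -> mdvd l (p * q).
Proof. by move=> lp; rewrite mulrC; apply: mdvdMl. Qed.

Lemma mdvdZ l c p : mdvd l p -> mdvd l (c *: p).
Proof. by move=> lp; rewrite -mul_mpolyC; apply: mdvdMl. Qed.

Lemma mdvd_pmul2l l p q : l != 0 -> mdvd (l * p) (l * q) -> mdvd p q.
Proof.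
move=> l0 [u e]; exists u; apply: (mulfI l0).
by rewrite e mulrCA.
Qed.

Lemma mdvd_prod (I : eqType) (s : seq I) (F : I -> {mpoly K[n]}) i :
  i \in s -> mdvd (F i) (\prod_(j <- s) F j).
Proof. by move=> si; rewrite (big_rem i) //=; apply/mdvdMr/mdvdnn. Qed.

(** Only the component of [q] of degree [e] contributes to degree [e + d] of [q * p]; then the
    nonzero [p] can be cancelled. *)
Lemma dhomog_quotient p q d e : p != 0 -> p \is d.-homog ->
  q * p \is (e + d).-homog -> q \is e.-homog.
Proof.
(* Taking [e.+1] into account makes [e] an index of the sum even if [q] has smaller degree. *)
move=> p0 pd qp; pose N := maxn (msize q) e.+1.
have qE : q = \sum_(k < N) pihomog mdeg k q.
  by apply: pihomog_partitionE; rewrite leq_maxl.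
have eN : (e < N)%N by rewrite leq_max leqnn orbT.
have : q * p = pihomog mdeg e q * p.
  rewrite -(pihomog_dE qp) {1}qE mulr_suml raddf_sum /=.
  rewrite (bigD1 (Ordinal eN)) //= pihomog_dE; last first.
    by apply: dhomogM => //; apply: pihomogP.
  rewrite big1 ?addr0 // => k ke.
  apply: (@pihomog_ne0 _ _ _ (k + d)%N); last first.
    by apply: dhomogM => //; apply: pihomogP.
  by rewrite eqn_add2r eq_sym; apply: contra ke => /eqP ke; apply/eqP/val_inj.
by move=> /(mulIf p0) ->; apply: pihomogP.
Qed.

End Divisibility.

Lemma sum3E (V : nmodType) (F : 'I_3 -> V) :
  \sum_i F i = F 0 + F 1 + F 2.
Proof.
rewrite !big_ord_recr big_ord0 /= add0r.
by congr (F _ + F _ + F _); apply: val_inj.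
Qed.

Lemma ord3P (P : 'I_3 -> Prop) : P 0 -> P 1 -> P 2 -> forall i, P i.
Proof.
move=> P0 P1 P2 [[|[|[|m]]] Hm] //.
- by rewrite (_ : Ordinal Hm = 0) //; apply: val_inj.
- by rewrite (_ : Ordinal Hm = 1) //; apply: val_inj.
- by rewrite (_ : Ordinal Hm = 2) //; apply: val_inj.
Qed.

(** * Linear forms as primes, and products of distinct lines *)

Section LinearForms.

Variable K : fieldType.
Local Notation S := {mpoly K[3]}.
Implicit Types (a b : 'rV[K]_3) (A : seq 'rV[K]_3) (p q : S).

Local Notation lf := (@linear_form K).

Lemma linear_formE a : lf a = a 0 0 *: 'X_0 + a 0 1 *: 'X_1 + a 0 2 *: 'X_2.
Proof. exact: sum3E. Qed.

Lemma mderiv_linear_form a i : (lf a)^`M(i) = (a 0 i)%:MP.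
Proof.
rewrite raddf_sum (bigD1 i) //= mderivZ mderivX mnm1E eqxx scale1r.
rewrite -{1}[U_(i)%MM]add0m addmK mpolyX0 alg_mpolyC big1 ?addr0 // => j ji.
by rewrite mderivZ mderivX mnm1E (negPf ji) scale0r scaler0.
Qed.

Lemma linear_formB a b : lf (a - b) = lf a - lf b.
Proof. by rewrite !linear_formE !mxE !scalerBl; ring. Qed.

Lemma linear_formZ c a : lf (c *: a) = c *: lf a.
Proof. by rewrite !linear_formE !mxE !scalerDr !scalerA. Qed.

Lemma linear_form_eq0 a : (lf a == 0) = (a == 0).
Proof.
apply/eqP/eqP => [a0|->]; last by rewrite linear_formE !mxE !scale0r !addr0.
apply/rowP => i; rewrite mxE; apply/eqP; rewrite -(mpolyC_eq0 3).
by rewrite -mderiv_linear_form a0 mderiv0.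
Qed.

Lemma linear_form_homog a : lf a \is 1.-homog.
Proof. by apply: rpred_sum => i _; apply/dhomogZ; rewrite dhomogX /= mdeg1. Qed.

Lemma prod_linear_form_neq0 A : all (fun a => a != 0) A ->
  \prod_(a <- A) lf a != 0.
Proof.
move=> /allP A0; rewrite prodf_seq_neq0; apply/allP => a aA.
by rewrite linear_form_eq0 A0.
Qed.

Lemma prod_linear_form_homog A : \prod_(a <- A) lf a \is (size A).-homog.
Proof.
elim: A => [|a A IH]; first by rewrite big_nil dhomog1.
by rewrite big_cons /= -[(size A).+1]add1n; apply/dhomogM/IH/linear_form_homog.
Qed.

(* For [a 0 i != 0], the substitution that solves [lf a = 0] for the [i]-th
   variable; its kernel is the ideal of [lf a], which is thus prime. *)
Definition elim_var a i : 3.-tuple S :=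
  [tuple 'X_j - ((j == i)%:R / a 0 i) *: lf a | j < 3].

Lemma elim_var_linear_form a b i :
  lf b \mPo elim_var a i = lf b - (b 0 i / a 0 i) *: lf a.
Proof.
rewrite {1}/linear_form raddf_sum /=.
under eq_bigr do rewrite comp_mpolyZ comp_mpolyXU (nth_map ord0)
  ?size_enum_ord // nth_ord_enum scalerBr scalerA.
rewrite sumrB; congr (_ - _); rewrite (bigD1 i) //= eqxx mul1r.
by rewrite big1 ?addr0 // => j /negPf ->; rewrite mul0r mulr0 scale0r.
Qed.

(** Each variable is congruent to its image modulo [lf a], and congruence is preserved by sums and
    products. *)
Lemma elim_var_congr a i p : mdvd (lf a) (p - (p \mPo elim_var a i)).
Proof.
elim/mpolyind: p => [|c m p _ _ IH].
  by rewrite raddf0 subrr; apply: mdvd0.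
rewrite raddfD /= comp_mpolyZ opprD addrACA -scalerBr.
apply: mdvdD => //; apply: mdvdZ; rewrite comp_mpolyX mpolyXE_id.
pose R (u v : S) := mdvd (lf a) (u - v).
have RM u1 u2 v1 v2 : R u1 u2 -> R v1 v2 -> R (u1 * v1) (u2 * v2).
  move=> Ru Rv; rewrite /R.
  have -> : u1 * v1 - u2 * v2 = (u1 - u2) * v1 + u2 * (v1 - v2) by ring.
  by apply: mdvdD; [apply: mdvdMr | apply: mdvdMl].
have R1 : R 1 1 by rewrite /R subrr; apply: mdvd0.
apply: (big_ind2 R) => // j _.
elim: (m j) => [|k IHk]; rewrite ?expr0 ?exprS //; apply: RM => //.
rewrite tnth_mktuple /R opprB addrC subrK.
exact/mdvdZ/mdvdnn.
Qed.

Lemma mdvd_linear_formP a i p : a 0 i != 0 ->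
  mdvd (lf a) p <-> p \mPo elim_var a i = 0.
Proof.
move=> ai; split=> [[q ->]|p0].
  by rewrite rmorphM /= elim_var_linear_form divff // scale1r subrr mulr0.
by have := elim_var_congr a i p; rewrite p0 subr0.
Qed.

Lemma mdvd_linear_form_prime a p q : a != 0 ->
  mdvd (lf a) (p * q) -> mdvd (lf a) p \/ mdvd (lf a) q.
Proof.
move=> /rV0Pn[i ai]; rewrite !(mdvd_linear_formP _ ai) rmorphM /=.
by move=> /eqP; rewrite mulf_eq0 => /orP[]/eqP; [left|right].
Qed.

Lemma linear_form_mdvd a b : a != 0 -> mdvd (lf a) (lf b) ->
  exists c, b = c *: a.
Proof.
move=> /rV0Pn[i ai]; rewrite (mdvd_linear_formP _ ai) elim_var_linear_form.
rewrite -linear_formZ -linear_formB => /eqP.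
by rewrite linear_form_eq0 subr_eq0 => /eqP ->; eexists.
Qed.

Lemma linear_form_mdvd_prod a A : a != 0 ->
  mdvd (lf a) (\prod_(b <- A) lf b) ->
  exists2 b, b \in A & exists c, b = c *: a.
Proof.
move=> a0; elim: A => [|b A IH].
  rewrite big_nil; case/rV0Pn: a0 => i ai.
  by rewrite (mdvd_linear_formP _ ai) rmorph1 => /eqP; rewrite oner_eq0.
rewrite big_cons => /(mdvd_linear_form_prime a0)[/(linear_form_mdvd a0)ab|].
  by exists b; rewrite ?mem_head.
by move=> /IH[c cA ac]; exists c; rewrite // inE cA orbT.
Qed.

(** By primality, a form dividing the tail product would be proportional to a form of the tail. This
    drives the inductions on arrangements. *)
Lemma proj_distinct_cons a A : proj_distinct (a :: A) ->
  [/\ a != 0, ~ mdvd (lf a) (\prod_(b <- A) lf b) & proj_distinct A].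
Proof.
case/andP=> /= /andP[a0 A0] /andP[/allP aA dA]; split=> //; last exact/andP.
move=> /(linear_form_mdvd_prod a0)[b bA [c bE]].
have b0 := allP A0 _ bA; have := aA _ bA.
rewrite bE; move/negP; apply.
apply/eqmxP/eqmx_sym/eqmx_scale; apply: contraNneq b0 => c0.
by rewrite bE c0 scale0r.
Qed.

(** In the induction the prime head divides the quotient of [p] by the tail product, since it does
    not divide the tail product itself. *)
Lemma prod_linear_form_mdvd A p : proj_distinct A ->
  (forall a, a \in A -> mdvd (lf a) p) -> mdvd (\prod_(a <- A) lf a) p.
Proof.
elim: A => [|a A IH] dA Ap; first by rewrite big_nil; exists p; rewrite mulr1.
have [a0 aA dA'] := proj_distinct_cons dA.
have [|q pE] := IH dA'; first by move=> b bA; apply: Ap; rewrite inE bA orbT.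
have := Ap a (mem_head _ _); rewrite {1}pE => /(mdvd_linear_form_prime a0)[] //.
by move=> [u uE]; exists u; rewrite big_cons mulrA -uE.
Qed.

(** The head cannot divide [g], for it would then divide the tail product. Being prime it divides
    [h], and cancelling it leaves a factorization of the tail product with the same [g]. *)
Lemma prod_linear_form_reduced A : proj_distinct A ->
  reduced (\prod_(a <- A) lf a).
Proof.
elim: A => [|a A IH] dA g h; first by rewrite big_nil expr2 -mulrA mulrC =>
  /esym/mpoly_intro_unit.
have [a0 aA dA'] := proj_distinct_cons dA; rewrite big_cons => gh.
have l0 : lf a != 0 by rewrite linear_form_eq0.
have : mdvd (lf a) (g * (g * h)).
  by rewrite mulrA -expr2 -gh; apply/mdvdMr/mdvdnn.
have ndvd_g : ~ mdvd (lf a) g.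
  move=> [u gE]; apply: aA; exists (u ^+ 2 * h); apply: (mulfI l0).
  by rewrite gh gE; ring.
move=> /(mdvd_linear_form_prime a0)[//|/(mdvd_linear_form_prime a0)[//|[v hE]]].
apply: (IH dA' g v); apply: (mulfI l0).
by rewrite gh hE; ring.
Qed.

(** * Derivations tangent to an arrangement *)

Section Derivations.

Implicit Types r s : 'rV[S]_3.

(** The derivation with coefficient row [r]; [AR f r] says that it kills [f]. *)
Definition der r p : S := \sum_i r 0 i * p^`M(i).

Definition euler_row : 'rV[S]_3 := \row_i 'X_i.

Lemma der1 r : der r 1 = 0.
Proof. by rewrite /der big1 // => i _; rewrite -mpolyC1 mderivC mulr0. Qed.

Lemma derM r p q : der r (p * q) = der r p * q + p * der r q.
Proof.
rewrite /der mulr_suml mulr_sumr -big_split; apply: eq_bigr => i _ /=.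
by rewrite mderivM; ring.
Qed.

Lemma derD r s p : der (r + s) p = der r p + der s p.
Proof.
by rewrite /der -big_split; apply: eq_bigr => i _; rewrite mxE mulrDl.
Qed.

Lemma derZ u r p : der (u *: r) p = u * der r p.
Proof. by rewrite /der mulr_sumr; apply: eq_bigr => i _; rewrite mxE mulrA. Qed.

Lemma der_linear_form r a : der r (lf a) = \sum_i a 0 i *: r 0 i.
Proof.
by apply: eq_bigr => i _; rewrite mderiv_linear_form mulrC mul_mpolyC.
Qed.

Lemma der_euler_linear_form a : der euler_row (lf a) = lf a.
Proof. by rewrite der_linear_form; apply: eq_bigr => i _; rewrite mxE. Qed.

Lemma der_euler_prod A :
  der euler_row (\prod_(a <- A) lf a) = (size A)%:R * \prod_(a <- A) lf a.
Proof.
elim: A => [|a A IH]; first by rewrite big_nil der1 mul0r.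
by rewrite big_cons derM der_euler_linear_form IH /= -natr1; ring.
Qed.

(** Modulo the head form [l], the Leibniz rule leaves [der r l * p], and the prime [l] does not
    divide the tail product [p]. *)
Lemma mdvd_der_prod r A : proj_distinct A ->
  mdvd (\prod_(a <- A) lf a) (der r (\prod_(a <- A) lf a)) <->
  forall a, a \in A -> mdvd (lf a) (der r (lf a)).
Proof.
elim: A => [|a A IH] dA.
  by rewrite big_nil der1; split=> // _; apply: mdvd0.
have [a0 aA dA'] := proj_distinct_cons dA; rewrite big_cons derM.
have l0 : lf a != 0 by rewrite linear_form_eq0.
set l := lf a in l0 *; set p := \prod_(_ <- _) _ in aA IH *.
split=> [D b|D].
  have la : mdvd l (der r l).
    have : mdvd l (der r l * p).
      have -> : der r l * p = (der r l * p + l * der r p) - l * der r p by ring.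
      apply: mdvdB; last exact/mdvdMr/mdvdnn.
      by case: D => u ->; apply/mdvdMl/mdvdMr/mdvdnn.
    by case/(mdvd_linear_form_prime a0).
  rewrite inE => /predU1P[->//|]; apply: (IH dA').1.
  case: la D => u -> D; have : mdvd (l * p) (l * (u * p + der r p)).
    by move: D; congr mdvd; ring.
  move/(mdvd_pmul2l l0) => D'.
  have -> : der r p = (u * p + der r p) - u * p by ring.
  by apply: mdvdB D' _; apply/mdvdMl/mdvdnn.
have [u uE] := D a (mem_head _ _).
have [|v vE] := (IH dA').2; first by move=> b bA; apply: D; rewrite inE bA orbT.
by exists (u + v); rewrite vE /l uE; ring.
Qed.

Lemma der_prod_homog r e A : (forall i, r 0 i \is e.+1.-homog) ->
  der r (\prod_(a <- A) lf a) \is (e + size A).-homog.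
Proof.
move=> rh; elim: A => [|a A IH]; first by rewrite big_nil der1 dhomog0.
rewrite big_cons derM /= rpredD //.
  rewrite addnS -addSn; apply/dhomogM/prod_linear_form_homog.
  by rewrite der_linear_form; apply: rpred_sum => i _; apply: dhomogZ.
by rewrite addnS -[(e + _).+1]add1n; apply/dhomogM/IH/linear_form_homog.
Qed.

Lemma der_euler_prod_eq0 u A : proj_distinct A -> (size A)%:R != 0 :> K ->
  der (u *: euler_row) (\prod_(a <- A) lf a) = 0 -> u = 0.
Proof.
case/andP=> A0 _ sA; rewrite derZ der_euler_prod => /eqP.
rewrite !mulf_eq0 (negPf (prod_linear_form_neq0 A0)) orbF.
by rewrite -mpolyC_nat mpolyC_eq0 (negPf sA) orbF => /eqP.
Qed.

(** Tangency gives [der r f = h * f] for the product [f], and the Euler derivation multiplies [f] by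
    the number of lines, so [c] is [h] divided by that number. As [h] has degree [e], the correction
    has the degree of [r]. *)
Lemma syzygy_of_tangent r e A : proj_distinct A -> (size A)%:R != 0 :> K ->
  (forall i, r 0 i \is e.+1.-homog) ->
  (forall a, a \in A -> mdvd (lf a) (der r (lf a))) ->
  exists c, homog_syzygy (\prod_(a <- A) lf a) e.+1 (r - c *: euler_row).
Proof.
move=> dA sA rh /(mdvd_der_prod _ dA)[h hE].
have hh : h \is e.-homog.
  apply: (dhomog_quotient _ (prod_linear_form_homog A)).
    by apply: prod_linear_form_neq0; case/andP: dA.
  by rewrite -hE; apply: der_prod_homog.
exists ((size A)%:R^-1 *: h); split.
  rewrite /AR -/(der _ _) -scaleNr derD derZ der_euler_prod hE.
  rewrite mulNr -scalerAl mulrCA mulr_natl -scaler_nat scalerA mulVf //.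
  by rewrite scale1r subrr.
move=> i; rewrite !mxE; apply: rpredB; first exact: rh.
have Xi : ('X_i : S) \is 1.-homog by rewrite dhomogX /= mdeg1.
by have := dhomogM (dhomogZ (size A)%:R^-1 hh) Xi; rewrite addn1.
Qed.

End Derivations.
End LinearForms.

Definition row3 (V : nmodType) (a b c : V) : 'rV[V]_3 := \row_j [:: a; b; c]`_j.

(** * The lines of the arrangement and their distinctness *)

Section Arrangement.

Variable K : numFieldType.
Local Notation S := {mpoly K[3]}.
Local Notation lf := (@linear_form K).
Local Notation X := ('X_0 : S).
Local Notation Y := ('X_1 : S).
Local Notation Z := ('X_2 : S).

Lemma linear_form_row3 a b c : lf (row3 a b c) = a *: X + b *: Y + c *: Z.
Proof. by rewrite linear_formE !mxE. Qed.

Lemma der_row3 (p q r : S) a b c :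
  der (row3 p q r) (lf (row3 a b c)) = a *: p + b *: q + c *: r.
Proof. by rewrite der_linear_form sum3E !mxE. Qed.

Definition line_xy k : 'rV[K]_3 := row3 1 (- k%:R) 0.
Definition line_xz k : 'rV[K]_3 := row3 1 0 (- k%:R).

Lemma linear_form_xy k : lf (line_xy k) = X - k%:R * Y.
Proof.
by rewrite linear_form_row3 scale0r addr0 scale1r scaleNr scaler_nat mulr_natl.
Qed.

Lemma linear_form_xz k : lf (line_xz k) = X - k%:R * Z.
Proof.
by rewrite linear_form_row3 scale0r addr0 scale1r scaleNr scaler_nat mulr_natl.
Qed.

Lemma g_factor_xy i j :
  g_factor i j X Y = \prod_(a <- [seq line_xy k | k <- index_iota i j.+1]) lf a.
Proof. by rewrite big_map; apply: eq_bigr => k _; rewrite linear_form_xy. Qed.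

Lemma g_factor_xz i j :
  g_factor i j X Z = \prod_(a <- [seq line_xz k | k <- index_iota i j.+1]) lf a.
Proof. by rewrite big_map; apply: eq_bigr => k _; rewrite linear_form_xz. Qed.

Lemma eqmx_minor (u v : 'rV[K]_3) i j :
  (u == v)%MS -> u 0 i * v 0 j = u 0 j * v 0 i.
Proof. by case/andP=> /sub_rVP[c ->] _; rewrite !mxE; ring. Qed.

Lemma line_xy_distinct s : uniq s -> proj_distinct [seq line_xy k | k <- s].
Proof.
move=> us; apply/andP; split.
  apply/allP=> _ /mapP[k _ ->]; apply/eqP=> /rowP/(_ 0).
  by rewrite !mxE => /eqP; rewrite oner_eq0.
rewrite pairwise_map; rewrite uniq_pairwise in us.
apply: sub_pairwise us => k l.
apply: contraNN => /(eqmx_minor 0 1); rewrite !mxE /= mul1r mulr1.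
by move=> /oppr_inj/eqP; rewrite eqr_nat eq_sym.
Qed.

Lemma line_xz_distinct s : uniq s -> proj_distinct [seq line_xz k | k <- s].
Proof.
move=> us; apply/andP; split.
  apply/allP=> _ /mapP[k _ ->]; apply/eqP=> /rowP/(_ 0).
  by rewrite !mxE => /eqP; rewrite oner_eq0.
rewrite pairwise_map; rewrite uniq_pairwise in us.
apply: sub_pairwise us => k l.
apply: contraNN => /(eqmx_minor 0 2); rewrite !mxE /= mul1r mulr1.
by move=> /oppr_inj/eqP; rewrite eqr_nat eq_sym.
Qed.

Variables d1 d2 : nat.
Hypotheses (d1_ge2 : (2 <= d1)%N) (d1_le_d2 : (d1 <= d2)%N).

(** The ranges are half-open: [k] runs from [1] to [d1 - 1] and from [2] to [d2]. *)
Definition arr_lines : seq 'rV[K]_3 :=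
  row3 1 0 0 :: row3 0 1 (- 1) ::
  [seq line_xy k | k <- index_iota 1 d1] ++
  [seq line_xz k | k <- index_iota 2 d2.+1].

Let d1K : (d1 - 1).+1 = d1.
Proof. by rewrite subn1 prednK // ltnW. Qed.

Lemma size_arr_lines : size arr_lines = (d1 + d2)%N.
Proof.
by rewrite /= size_cat !size_map !size_iota; lia.
Qed.

Lemma size_arr_lines_neq0 : (size arr_lines)%:R != 0 :> K.
Proof. by rewrite size_arr_lines pnatr_eq0; lia. Qed.

Lemma arr_poly_lines : arr_poly K d1 d2 = \prod_(a <- arr_lines) lf a.
Proof.
rewrite /arr_poly g_factor_xy g_factor_xz d1K !big_cons big_cat /=.
rewrite !linear_form_row3 !scale0r !scale1r scaleN1r !addr0 add0r.
by rewrite !mulrA.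
Qed.

Lemma arr_lines_distinct : proj_distinct arr_lines.
Proof.
have /andP[nxy dxy] := line_xy_distinct (iota_uniq 1 (d1 - 1)).
have /andP[nxz dxz] := line_xz_distinct (iota_uniq 2 (d2.+1 - 2)).
have ne (u v : 'rV[K]_3) i j :
    u 0 i * v 0 j - u 0 j * v 0 i != 0 -> ~~ (u == v)%MS.
  by apply: contraNN => /(eqmx_minor i j) ->; rewrite subrr.
have ne0 (k : nat) : (0 < k)%N -> k%:R != 0 :> K by rewrite pnatr_eq0 lt0n.
apply/andP; split.
  rewrite /arr_lines /= all_cat nxy nxz !andbT; apply/andP; split.
    apply/eqP=> /rowP/(_ 0); rewrite !mxE => /eqP; by rewrite oner_eq0.
  apply/eqP=> /rowP/(_ 1); rewrite !mxE => /eqP; by rewrite oner_eq0.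
rewrite /arr_lines /= !all_cat pairwise_cat dxy dxz !andbT.
apply/and3P; split; [apply/and3P; split | apply/andP; split |].
- by apply: (ne _ _ 0 1); rewrite !mxE /= mulr1 mul0r subr0 oner_eq0.
- apply/allP=> _ /mapP[k + ->]; rewrite mem_index_iota => /andP[k0 _].
  apply: (ne _ _ 0 1); rewrite !mxE /= mul1r mul0r subr0 oppr_eq0.
  exact: ne0.
- apply/allP=> _ /mapP[k + ->]; rewrite mem_index_iota => /andP[k0 _].
  apply: (ne _ _ 0 2); rewrite !mxE /= mul1r mul0r subr0 oppr_eq0.
  by apply: ne0; apply: leq_trans k0.
- apply/allP=> _ /mapP[k _ ->].
  apply: (ne _ _ 0 2); rewrite !mxE /= mulr1 mul0r sub0r opprK.
  exact: oner_neq0.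
- apply/allP=> _ /mapP[k _ ->].
  apply: (ne _ _ 0 1); rewrite !mxE /= mulr1 mul0r sub0r oppr_eq0.
  exact: oner_neq0.
- apply/allrelP=> _ _ /mapP[k k0 ->] /mapP[l _ ->].
  apply: (ne _ _ 0 1); rewrite !mxE /= mulr0 mulr1 sub0r opprK.
  by apply: ne0; move: k0; rewrite mem_index_iota => /andP[].
Qed.

(** * Restriction of the line products to [y = z] *)

Local Notation P := (g_factor 1 (d1 - 1) X Y).
Local Notation Q := (g_factor 2 d2 X Z).
Local Notation H := (g_factor d1 d2 X Y).

Lemma g_factor_morph (phi : {rmorphism S -> S}) i j u v :
  phi (g_factor i j u v) = g_factor i j (phi u) (phi v).
Proof.
rewrite rmorph_prod; apply: eq_bigr => k _.
by rewrite rmorphB rmorphM rmorph_nat.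
Qed.

Lemma meval_g_factor (w : 'I_3 -> K) i j u v :
  (g_factor i j u v).@[w] = \prod_(i <= k < j.+1) (u.@[w] - k%:R * v.@[w]).
Proof.
rewrite rmorph_prod; apply: eq_bigr => k _.
by rewrite rmorphB rmorphM rmorph_nat.
Qed.

Lemma g_factor_xy_homog i j : g_factor i j X Y \is (j.+1 - i).-homog.
Proof.
rewrite g_factor_xy; set A := map _ _.
by have := prod_linear_form_homog A; rewrite size_map size_iota.
Qed.

Lemma g_factor_xz_homog i j : g_factor i j X Z \is (j.+1 - i).-homog.
Proof.
rewrite g_factor_xz; set A := map _ _.
by have := prod_linear_form_homog A; rewrite size_map size_iota.
Qed.

Local Notation line_yz := (row3 (0 : K) 1 (- 1)).

Lemma linear_form_yz : lf line_yz = Y - Z.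
Proof. by rewrite linear_form_row3 scale0r add0r scale1r scaleN1r. Qed.

Local Notation subst_zy := (comp_mpoly (elim_var line_yz 2)).

Lemma subst_zy_var : [/\ subst_zy X = X, subst_zy Y = Y & subst_zy Z = Y].
Proof.
have sE i : subst_zy 'X_i = 'X_i + (i == 2)%:R * (Y - Z).
  rewrite comp_mpolyXU (nth_map ord0) ?size_enum_ord // nth_ord_enum.
  rewrite linear_form_yz !mxE /= invrN invr1 mulrN1 scaleNr opprK.
  by rewrite scaler_nat mulr_natl.
by rewrite !sE /= !mul0r !addr0 mul1r addrC subrK.
Qed.

Lemma mdvd_yzP p : mdvd (Y - Z) p <-> subst_zy p = 0.
Proof.
rewrite -linear_form_yz; apply: mdvd_linear_formP.
by rewrite !mxE /= oppr_eq0 oner_eq0.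
Qed.

Lemma subst_zy_congr p : mdvd (Y - Z) (p - subst_zy p).
Proof. by rewrite -linear_form_yz; apply: elim_var_congr. Qed.

Lemma subst_zy_P : subst_zy P = P.
Proof. by rewrite g_factor_morph /=; case: subst_zy_var => -> -> _. Qed.

Lemma subst_zy_Q : subst_zy Q = g_factor 2 d2 X Y.
Proof. by rewrite g_factor_morph /=; case: subst_zy_var => -> _ ->. Qed.

(** The factors with [2 <= k < d1] are shared by [P] and the restriction of [Q]; for [d1 = 2] this
    common part is the empty product. *)
Lemma P_split : P = (X - Y) * g_factor 2 (d1 - 1) X Y.
Proof. by rewrite /g_factor d1K big_ltn // mul1r. Qed.

Lemma Q_split : g_factor 2 d2 X Y = g_factor 2 (d1 - 1) X Y * H.
Proof. by rewrite /g_factor d1K -big_cat_nat // leqW. Qed.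

Lemma g_factor_xy_neq0 i j : g_factor i j X Y != 0.
Proof.
rewrite g_factor_xy; apply: prod_linear_form_neq0.
by case/andP: (line_xy_distinct (iota_uniq i (j.+1 - i))).
Qed.

Lemma g_factor_xz_neq0 i j : g_factor i j X Z != 0.
Proof.
rewrite g_factor_xz; apply: prod_linear_form_neq0.
by case/andP: (line_xz_distinct (iota_uniq i (j.+1 - i))).
Qed.

(** * Tangent derivations without [d/dx] term, and their generators *)

Lemma tangentP (p q : S) :
  (forall a, a \in arr_lines -> mdvd (lf a) (der (row3 0 p q) (lf a))) <->
  [/\ mdvd P p, mdvd Q q & mdvd (Y - Z) (p - q)].
Proof.
(* Tangency to a line of index [k] only concerns [- k] times a coefficient, and [k] is invertible in
   characteristic zero. *)
have ZK k (l u : S) : (0 < k)%N -> mdvd l (- (k%:R : K) *: u) -> mdvd l u.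
  move=> k0 /(mdvdZ (- (k%:R : K))^-1); rewrite scalerA mulVf ?scale1r //.
  by rewrite oppr_eq0 pnatr_eq0 -lt0n.
have der_xy k : der (row3 0 p q) (lf (line_xy k)) = - k%:R *: p.
  by rewrite der_row3 scale0r scaler0 add0r addr0.
have der_xz k : der (row3 0 p q) (lf (line_xz k)) = - k%:R *: q.
  by rewrite der_row3 scale0r scaler0 !add0r.
have der_yz : der (row3 0 p q) (lf line_yz) = p - q.
  by rewrite der_row3 scale0r add0r scale1r scaleN1r.
have der_x : der (row3 0 p q) (lf (row3 1 0 0)) = 0.
  by rewrite der_row3 !scale0r scaler0 !addr0.
split=> [D|[Pp Qq pq] a].
  split.
  - rewrite g_factor_xy d1K; apply: prod_linear_form_mdvd.
      exact/line_xy_distinct/iota_uniq.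
    move=> _ /mapP[k ki ->]; apply: (ZK k).
      by move: ki; rewrite mem_index_iota => /andP[].
    by rewrite -der_xy; apply: D; rewrite !inE mem_cat map_f // !orbT.
  - rewrite g_factor_xz; apply: prod_linear_form_mdvd.
      exact/line_xz_distinct/iota_uniq.
    move=> _ /mapP[k ki ->]; apply: (ZK k).
      by move: ki; rewrite mem_index_iota => /andP[k2 _]; apply: leq_trans k2.
    by rewrite -der_xz; apply: D; rewrite !inE mem_cat map_f ?orbT.
  by rewrite -der_yz -linear_form_yz; apply: D; rewrite !inE eqxx orbT.
rewrite !inE mem_cat => /or4P[/eqP->|/eqP->|/mapP[k ki ->]|/mapP[k ki ->]].
- by rewrite der_x; apply: mdvd0.
- by rewrite der_yz linear_form_yz.
- rewrite der_xy; apply: mdvdZ; case: Pp => u ->; apply: mdvdMl.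
  by rewrite g_factor_xy d1K; apply/mdvd_prod/map_f.
- rewrite der_xz; apply: mdvdZ; case: Qq => u ->; apply: mdvdMl.
  by rewrite g_factor_xz; apply/mdvd_prod/map_f.
Qed.

(** The degrees are [d1], [d2], [d2]; in the last row [H] has degree [d2 - d1 + 1] and [P] degree
    [d1 - 1]. *)
Definition tangent_gen : seq 'rV[S]_3 :=
  [:: row3 0 ((Y - Z) * P) 0; row3 0 0 ((Y - Z) * Q);
      row3 0 (H * P) ((X - Y) * Q)].

Lemma tangent_gen_tangent k a : (k < 3)%N -> a \in arr_lines ->
  mdvd (lf a) (der (tangent_gen`_k) (lf a)).
Proof.
case: k => [|[|[|//]]] _ /=; move: a; apply/tangentP; split.
- exact/mdvdMl/mdvdnn.
- exact: mdvd0.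
- by rewrite subr0; apply/mdvdMr/mdvdnn.
- exact: mdvd0.
- exact/mdvdMl/mdvdnn.
- by rewrite sub0r; apply/mdvdN/mdvdMr/mdvdnn.
- exact/mdvdMl/mdvdnn.
- exact/mdvdMl/mdvdnn.
apply/mdvd_yzP; rewrite rmorphB !rmorphM rmorphB /= subst_zy_P subst_zy_Q.
rewrite g_factor_morph /=; case: subst_zy_var => -> -> _.
by rewrite P_split Q_split; ring.
Qed.

Lemma tangent_gen_homog k i : (k < 3)%N ->
  (tangent_gen`_k) 0 i \is (nth 0%N [:: d1.-1; d2.-1; d2.-1] k).+1.-homog.
Proof.
have XX (l : 'I_3) : ('X_l : S) \is 1.-homog by rewrite dhomogX /= mdeg1.
have XB (l m : 'I_3) : ('X_l - 'X_m : S) \is 1.-homog.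
  by apply: rpredB; apply: XX.
have Ph := g_factor_xy_homog 1 (d1 - 1).
have Qh := g_factor_xz_homog 2 d2.
have Hh := g_factor_xy_homog d1 d2.
have cast (u : S) m m' : m = m' -> u \is m.-homog -> u \is m'.-homog by move->.
case: k => [|[|[|//]]] _ /=; elim/ord3P: i; rewrite !mxE /= ?dhomog0 //.
- by apply: cast (dhomogM (XB _ _) Ph); lia.
- by apply: cast (dhomogM (XB _ _) Qh); lia.
- by apply: cast (dhomogM Hh Ph); lia.
- by apply: cast (dhomogM (XB _ _) Qh); lia.
Qed.

Lemma tangent_gen_span (p q : S) :
  (forall a, a \in arr_lines -> mdvd (lf a) (der (row3 0 p q) (lf a))) ->
  exists b : 'I_3 -> S, row3 0 p q = \sum_i b i *: tangent_gen`_i.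
Proof.
case/tangentP=> -[b pE] [c qE]; rewrite mdvd_yzP rmorphB pE qE !rmorphM /=.
rewrite subst_zy_P subst_zy_Q P_split Q_split => /eqP.
set G := g_factor 2 _ X Y; rewrite subr_eq0 => /eqP bc.
have G0 : G != 0 by apply: g_factor_xy_neq0.
have {}bc : subst_zy b * (X - Y) = subst_zy c * H.
  by apply: (mulIf G0); rewrite -!mulrA bc [H * G]mulrC.
have l0 : line_xy 1 != 0.
  by have /andP[/andP[]] := line_xy_distinct (isT : uniq [:: 1%N]).
have lE : X - Y = lf (line_xy 1) by rewrite linear_form_xy mul1r.
(* The prime [X - Y] does not divide [H], whose factors have index [k >= d1 >= 2]. *)
have [t tE] : mdvd (X - Y) (subst_zy c).
  have : mdvd (X - Y) (subst_zy c * H) by rewrite -bc; apply/mdvdMl/mdvdnn.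
  rewrite lE => /(mdvd_linear_form_prime l0)[//|].
  rewrite g_factor_xy => /(linear_form_mdvd_prod l0)[_ /mapP[k ki ->] [e eE]].
  move: ki; rewrite mem_index_iota => /andP[d1k _].
  have := congr1 (fun r : 'rV[K]_3 => (r 0 0, r 0 1)) eE.
  rewrite !mxE /= mulr1 => -[<-]; rewrite mul1r => /oppr_inj/eqP.
  by rewrite eqr_nat => /eqP k1; move: d1_ge2; rewrite k1 in d1k; lia.
have bE : subst_zy b = t * H.
  have XY0 : X - Y != 0 by rewrite lE linear_form_eq0.
  by apply: (mulIf XY0); rewrite bc tE mulrAC.
(* Lifting back from [y = z] gives [b = u (Y - Z) + t H] and [c = v (Y - Z) + t (X - Y)], so [u],
   [v], [t] are the coefficients sought. *)
have [u uE] := subst_zy_congr b; have [v vE] := subst_zy_congr c.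
exists (fun i => [:: u; v; t]`_i); rewrite sum3E /=.
move/eqP: uE; rewrite bE subr_eq => /eqP ->.
move/eqP: vE; rewrite tE subr_eq => /eqP ->.
by apply/rowP; elim/ord3P; rewrite !mxE /= ?P_split -/G; ring.
Qed.

(** * From tangent derivations to minimal generators of the syzygies *)

Lemma arr_poly_generators (r : 'I_3 -> 'rV[S]_3) (c : 'I_3 -> S) :
  (forall i, AR (arr_poly K d1 d2) (r i)) ->
  (forall i, r i = tangent_gen`_i - c i *: euler_row K) ->
  generated_by (AR (arr_poly K d1 d2)) r [set: 'I_3].
Proof.
rewrite arr_poly_lines; set f := \prod_(_ <- _) _ => rAR rE s.
rewrite /AR -/(der s f).
have sT a : \sum_(i in [set: 'I_3]) a i *: r i = \sum_i a i *: r i.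
  by apply: eq_bigl => i; rewrite inE.
have r0 a : der (\sum_i a i *: r i) f = 0.
  by rewrite sum3E !derD !derZ [der (r 0) f]rAR [der (r 1) f]rAR
    [der (r 2) f]rAR !mulr0 !addr0.
split=> [s0|[a ->]]; last by rewrite sT r0.
have D a : a \in arr_lines -> mdvd (lf a) (der s (lf a)).
  apply: (mdvd_der_prod s arr_lines_distinct).1; rewrite -/f s0.
  exact: mdvd0.
(* Tangency to [x = 0] makes the first coefficient a multiple of [X], so that a multiple of the
   Euler row removes it. *)
have [e eE] : mdvd X (s 0 0).
  have := D (row3 1 0 0) (mem_head _ _).
  rewrite der_linear_form sum3E linear_form_row3 !mxE /=.
  by rewrite !scale1r !scale0r !addr0.
pose b := s 0 1 - e * Y; pose b' := s 0 2 - e * Z.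
have sE : s = e *: euler_row K + row3 0 b b'.
  by apply/rowP; elim/ord3P; rewrite !mxE /= ?addr0 1?addrC ?subrK.
have [a aE] : exists a : 'I_3 -> S, row3 0 b b' = \sum_i a i *: tangent_gen`_i.
  apply: tangent_gen_span => l lA.
  have -> : der (row3 0 b b') (lf l) = der s (lf l) - e * lf l.
    by rewrite sE derD derZ der_euler_linear_form addrC addKr.
  by apply: mdvdB (D _ lA) _; apply/mdvdMl/mdvdnn.
have {}sE : s = (e + \sum_i a i * c i) *: euler_row K + \sum_i a i *: r i.
  rewrite sE aE scalerDl -addrA; congr (_ + _); rewrite scaler_suml -big_split.
  by apply: eq_bigr => i _; rewrite /= rE scalerBr scalerA addrC subrK.
(* Both [s] and the combination of the [r i] kill [f], hence so does the remaining multiple of the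
   Euler row, which must then be zero. *)
exists a; rewrite sT {1}sE [e + _](_ : _ = 0) ?scale0r ?add0r //.
apply: (der_euler_prod_eq0 arr_lines_distinct).
  exact: size_arr_lines_neq0.
by move: s0; rewrite -/f sE [der (_ + _) _]derD r0 addr0.
Qed.

Lemma tangent_gen_indep (i : 'I_3) (b : 'I_3 -> S) : b i = 0 ->
  tangent_gen`_i <> \sum_j b j *: tangent_gen`_j.
Proof.
have P0 : P != 0 by apply: g_factor_xy_neq0.
have Q0 : Q != 0 by apply: g_factor_xz_neq0.
elim/ord3P: i => b0 /rowP E.
- have := E 1; rewrite sum3E !mxE /= b0 !mulr0 mul0r !add0r mulrA.
  move=> /(mulIf P0).
  (* The relation is now [Y - Z = b 2 * H], and the factor [X - d1 Y] of [H] vanishes at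
     [(d1 : 1 : 0)]. *)
  move=> /(congr1 (meval [eta row3 d1%:R 1 0 0])).
  rewrite rmorphB rmorphM /= meval_g_factor big_ltn // !mevalXU !mxE /=.
  by rewrite mulr1 subrr mul0r mulr0 subr0 => /eqP; rewrite oner_eq0.
- have := E 2; rewrite sum3E !mxE /= b0 !mulr0 mul0r !add0r mulrA.
  move=> /(mulIf Q0).
  (* The relation is now [Y - Z = b 2 * (X - Y)]. *)
  move=> /(congr1 (meval [eta row3 1 1 0 0])).
  rewrite rmorphB rmorphM rmorphB /= !mevalXU !mxE /=.
  by rewrite subrr mulr0 subr0 => /eqP; rewrite oner_eq0.
have := E 1; rewrite sum3E !mxE /= b0 !mulr0 mul0r !addr0 mulrA => /(mulIf P0).
(* The relation is now [H = b 0 * (Y - Z)], and every factor of [H] is [1] at [(1 : 0 : 0)]. *)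
move=> /(congr1 (meval [eta row3 1 0 0 0])).
rewrite rmorphM rmorphB /= meval_g_factor !mevalXU !mxE /=.
under eq_bigr do rewrite mulr0 subr0.
by rewrite big1_eq subrr mulr0 => /eqP; rewrite oner_eq0.
Qed.

(** Comparing first coordinates, where the [g j] vanish, shows that the [c j] satisfy the same
    relation, so the Euler terms cancel. Independence thus passes from the tangent derivations to
    the syzygies. *)
Lemma sum_sub_euler_eq (g : 'I_3 -> 'rV[S]_3) (b c : 'I_3 -> S) i :
  (forall j, g j 0 0 = 0) ->
  g i - c i *: euler_row K = \sum_j b j *: (g j - c j *: euler_row K) ->
  g i = \sum_j b j *: g j.
Proof.
move=> g0 E.
have X0 : X != 0.
  have := linear_form_eq0 (row3 (1 : K) 0 0).
  rewrite linear_form_row3 scale1r !scale0r !addr0 => ->.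
  by apply/eqP=> /rowP/(_ 0); rewrite !mxE => /eqP; rewrite oner_eq0.
have subE j l : (g j - c j *: euler_row K) 0 l = g j 0 l - c j * 'X_l.
  by rewrite !mxE.
have El l : g i 0 l - c i * 'X_l = \sum_j b j * (g j 0 l - c j * 'X_l).
  by rewrite -subE E summxE; apply: eq_bigr => j _; rewrite mxE subE.
have cE : c i = \sum_j b j * c j.
  apply: (mulIf X0); apply: oppr_inj; have := El 0; rewrite g0 sub0r => ->.
  rewrite mulr_suml -sumrN; apply: eq_bigr => j _.
  by rewrite g0 sub0r mulrN mulrA.
apply/rowP=> k; rewrite summxE; have /eqP := El k.
rewrite subr_eq cE mulr_suml -big_split => /eqP ->; apply: eq_bigr => j _.
by rewrite mxE /=; ring.
Qed.

Lemma arr_poly_minimally_generated :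
  minimally_generated_in_degrees (arr_poly K d1 d2) [:: d1; d2; d2].
Proof.
have /fin_all_exists[c cP] (i : 'I_3) : exists c,
    homog_syzygy (arr_poly K d1 d2) (nth 0%N [:: d1; d2; d2] i)
      (tangent_gen`_i - c *: euler_row K).
  rewrite arr_poly_lines.
  have -> : nth 0%N [:: d1; d2; d2] i =
      (nth 0%N [:: d1.-1; d2.-1; d2.-1] i).+1.
    by elim/ord3P: i => /=; lia.
  apply: syzygy_of_tangent.
  - exact: arr_lines_distinct.
  - exact: size_arr_lines_neq0.
  - by move=> j; apply: tangent_gen_homog.
  - by move=> a; apply: tangent_gen_tangent.
exists (fun i : 'I_3 => tangent_gen`_i - c i *: euler_row K); split=> //.
  by apply: (arr_poly_generators (c := c)) => // i; case: (cP i).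
(* If [i] were missing from [J], coefficients extended by zero outside [J] would express generator
   [i] through the others. *)
move=> J JP; apply/setP=> i; rewrite inE; apply/negP=> /negP iJ.
have [a aE] := (JP _).1 (proj1 (cP i)).
pose b j := if j \in J then a j else 0.
have bi : b i = 0 by rewrite /b (negPf iJ).
apply: (tangent_gen_indep bi).
apply: (sum_sub_euler_eq (g := fun j : 'I_3 => tangent_gen`_j) (c := c)).
  by elim/ord3P; rewrite mxE.
rewrite aE big_mkcond; apply: eq_bigr => j _.
by rewrite /b; case: ifP => // _; rewrite scale0r.
Qed.

Lemma arr_poly_nearly_free : nearly_free (arr_poly K d1 d2) d1 d2.
Proof.
split=> //; last exact: arr_poly_minimally_generated.
- by rewrite arr_poly_lines -size_arr_lines prod_linear_form_homog.
- by rewrite arr_poly_lines; apply/prod_linear_form_reduced/arr_lines_distinct.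
Qed.

(** * Points of multiplicity greater than three *)

Lemma meval_linear_form_row3 (a b c : K) p :
  (lf (row3 a b c)).@[p] = a * p 0 + b * p 1 + c * p 2.
Proof. by rewrite linear_form_row3 !mevalD !mevalZ !mevalXU. Qed.

(** Two distinct indices would give [k v = u = l v], so [v = 0] in characteristic zero, and then
    [u = 0]. *)
Lemma count_line_le1 (s : seq nat) (u v : K) : uniq s -> (u != 0) || (v != 0) ->
  (count (fun k => u - k%:R * v == 0)%R s <= 1)%N.
Proof.
move=> us uv; rewrite -size_filter.
have : uniq [seq k <- s | u - k%:R * v == 0] by rewrite filter_uniq.
case E : [seq _ <- _ | _] => [|k [|l t]] //= /and3P[].
have : k \in [seq k <- s | u - k%:R * v == 0] by rewrite E inE eqxx.
have : l \in [seq k <- s | u - k%:R * v == 0] by rewrite E !inE eqxx orbT.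
rewrite !mem_filter !subr_eq0 => /andP[/eqP ul _] /andP[/eqP uk _].
rewrite inE negb_or => /andP[kl _] _ _.
have v0 : v != 0.
  by case/orP: uv => //; apply: contraNneq => v0; rewrite ul v0 mulr0.
have /(mulIf v0)/eqP := etrans (esym uk) ul.
by rewrite eqr_nat (negPf kl).
Qed.

Lemma multiplicity_arr_lines (p : 'rV[K]_3) : p != 0 ->
  (3 < multiplicity arr_lines p)%N ->
  (p == row3 0 1 0)%MS || (p == row3 0 0 1)%MS.
Proof.
move=> p0; rewrite /multiplicity /arr_lines /= count_cat !count_map.
set nx := count _ (index_iota 1 _); set nz := count _ (index_iota 2 _).
have nxE : nx = count (fun k => p 0 0 - k%:R * p 0 1 == 0) (index_iota 1 d1).
  apply: eq_count => k /=.
  by rewrite linear_form_xy rmorphB rmorphM rmorph_nat /= !mevalXU.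
have nzE : nz = count (fun k => p 0 0 - k%:R * p 0 2 == 0) (index_iota 2 d2.+1).
  apply: eq_count => k /=.
  by rewrite linear_form_xz rmorphB rmorphM rmorph_nat /= !mevalXU.
have nx1 : (p 0 0 != 0) || (p 0 1 != 0) -> (nx <= 1)%N.
  by rewrite nxE; apply/count_line_le1/iota_uniq.
have nz1 : (p 0 0 != 0) || (p 0 2 != 0) -> (nz <= 1)%N.
  by rewrite nzE; apply/count_line_le1/iota_uniq.
rewrite !meval_linear_form_row3 !mul0r mul1r !addr0 add0r mulN1r mul1r subr_eq0.
(* Off [x = 0] each pencil contributes at most one line, and [y = z] at most one more: three in
   all. *)
have [x0|x0] := eqVneq (p 0 0) 0; last first.
  move: (nx1 (introT orP (or_introl x0))) (nz1 (introT orP (or_introl x0))).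
  by case: (_ == _) => /=; lia.
have [y0|y0] := eqVneq (p 0 1) 0.
  have z0 : p 0 2 != 0.
    by apply: contraNneq p0 => z0; apply/eqP/rowP; elim/ord3P; rewrite mxE.
  move=> _; apply/orP; right; have -> : p = p 0 2 *: row3 0 0 1.
    by apply/rowP; elim/ord3P; rewrite !mxE /= ?x0 ?y0 ?mulr0 ?mulr1.
  exact/eqmxP/eqmx_scale.
have [z0|z0] := eqVneq (p 0 2) 0.
  move=> _; apply/orP; left; have -> : p = p 0 1 *: row3 0 1 0.
    by apply/rowP; elim/ord3P; rewrite !mxE /= ?x0 ?z0 ?mulr0 ?mulr1.
  exact/eqmxP/eqmx_scale.
(* With [x = 0] and both [y] and [z] nonzero, neither pencil contributes, which leaves only [x = 0]
   and possibly [y = z]. *)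
have nx0 : nx = 0%N.
  rewrite nxE -(@eq_in_count _ pred0) ?count_pred0 // => k.
  rewrite mem_index_iota => /andP[k1 _] /=.
  by rewrite x0 sub0r oppr_eq0 mulf_eq0 (negPf y0) orbF pnatr_eq0; lia.
have nz0 : nz = 0%N.
  rewrite nzE -(@eq_in_count _ pred0) ?count_pred0 // => k.
  rewrite mem_index_iota => /andP[k1 _] /=.
  by rewrite x0 sub0r oppr_eq0 mulf_eq0 (negPf z0) orbF pnatr_eq0; lia.
by rewrite nx0 nz0; case: (_ == _).
Qed.

End Arrangement.

(** * Independence of the multiplicity from the chosen linear factors *)

Lemma eqmx_row_common (K : fieldType) (a b w : 'rV[K]_3) :
  (a == w)%MS -> (b == w)%MS -> (a == b)%MS.
Proof.
by move=> /eqmxP aw /eqmxP bw; apply/eqmxP/(eqmx_trans aw)/eqmx_sym.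
Qed.

(** By primality each line of [A] is proportional to one of [B], and distinct lines to distinct
    ones, so the lines through [p] inject. This carries the bound from [arr_lines] to every
    arrangement with the same product. *)
Lemma multiplicity_le (K : fieldType) (A B : seq 'rV[K]_3) (p : 'rV[K]_3) :
  proj_distinct A -> proj_distinct B ->
  \prod_(a <- A) linear_form a = \prod_(b <- B) linear_form b ->
  (multiplicity A p <= multiplicity B p)%N.
Proof.
move=> /andP[/allP A0 pA] /andP[/allP B0 _] AB.
pose par (a b : 'rV[K]_3) := (a == b)%MS.
have find_par a : a \in A -> has (par a) B.
  move=> aA; have [b bB [c bE]] : exists2 b, b \in B & exists c, b = c *: a.
    by apply: linear_form_mdvd_prod; rewrite ?A0 // -AB; apply: mdvd_prod.
  apply/hasP; exists b => //; rewrite /par bE; apply/eqmxP/eqmx_sym/eqmx_scale.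
  by apply: contraNneq (B0 _ bB) => c0; rewrite bE c0 scale0r.
(* The default [0] is never reached for [a] in [A], by [find_par]. *)
pose m a := nth 0 B (find (par a) B).
have mB a : a \in A -> m a \in B.
  by move=> aA; rewrite mem_nth // -has_find find_par.
have mP a : a \in A -> (a == m a)%MS.
  by move=> aA; apply: (nth_find 0 (find_par _ aA)).
have um : uniq (map m A).
  rewrite uniq_pairwise pairwise_map; apply: (@sub_in_pairwise _ (mem A)) pA.
    move=> a b aA bA; apply: contraNN => /eqP mab.
    apply: (eqmx_row_common (mP a aA)); rewrite mab; exact: mP.
  exact/allP.
rewrite /multiplicity -!size_filter -(size_map m); apply: uniq_leq_size.
  exact/(subseq_uniq _ um)/map_subseq/filter_subseq.
move=> _ /mapP[a + ->]; rewrite !mem_filter => /andP[/eqP ap aA].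
rewrite mB // andbT; have /andP[_ /sub_rVP[c ->]] := mP a aA.
by rewrite linear_formZ mevalZ ap mulr0.
Qed.

(** Pigeonhole: of three entries, two would give the same projective point. *)
Lemma size_le2 (K : fieldType) (s : seq 'rV[K]_3) (u v : 'rV[K]_3) :
  proj_distinct s -> (forall p, p \in s -> (p == u)%MS || (p == v)%MS) ->
  (size s <= 2)%N.
Proof.
case: s => [|p [|q [|r s]]] // /andP[_ /=].
move=> /andP[/and3P[pq pr _] /andP[/andP[qr _] _]].
move=> suv; have := suv p; have := suv q; have := suv r.
rewrite !inE !eqxx !orbT.
move=> /(_ isT)/orP[] ru /(_ isT)/orP[] qu /(_ isT)/orP[] pu;
  by move: pq pr qr; rewrite ?(eqmx_row_common pu qu) ?(eqmx_row_common pu ru)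
    ?(eqmx_row_common qu ru).
Qed.

Theorem theorem3p4 (R : realType) (d1 d2 : nat)
    (hd1 : (2 <= d1)%N) (hd12 : (d1 <= d2)%N) :
  let f : {mpoly R[i][3]} := arr_poly R[i] d1 d2 in
  (exists A : seq 'rV[R[i]]_3,
      line_arrangement A f /\ size A = (d1 + d2)%N) /\
  nearly_free f d1 d2 /\
  (forall A : seq 'rV[R[i]]_3, line_arrangement A f ->
     forall s : seq 'rV[R[i]]_3, proj_distinct s ->
       (forall p, p \in s -> (3 < multiplicity A p)%N) -> (size s <= 2)%N).
Proof.
move=> f; have dL := arr_lines_distinct R[i] d1 d2.
have fL : f = \prod_(a <- arr_lines R[i] d1 d2) linear_form a.
  exact: arr_poly_lines.
split.
  by exists (arr_lines R[i] d1 d2); split; last exact: size_arr_lines.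
split; first exact: arr_poly_nearly_free.
move=> A [dA fA] s ds sA.
apply: (size_le2 (u := row3 0 1 0) (v := row3 0 0 1) ds).
move=> p ps; apply: (multiplicity_arr_lines hd1 hd12).
  by case/andP: ds => /allP/(_ _ ps).
apply: leq_trans (sA p ps) _; apply: multiplicity_le => //.
by rewrite -fA.
Qed.
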